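(* Let $J,H:\mathbb R^n\to\mathbb R$ be proper, convex, lower semi-continuous and absolutely one-homogeneous, let $\lambda>0$, $A\in\mathbb R^{m\times n}$, $f\in\mathbb R^m$. If $A$ is coercive, i.e. there exists $c>0$ such that $\|Au\|_2\ge c\|u\|_2$ for all $u\in\mathbb R^n$, then any differentiable function $u:[0,\infty)\to\mathbb R^n$ satisfying the flow $$u_t=-\lambda A^T(Au-f)-\frac{p-R(u)q}{H(u)},\qquad p(t)\in\partial J(u(t)),\ q(t)\in\partial H(u(t)),$$ is uniformly bounded, i.e. $\sup_{t\ge0}\|u(t)\|_2<\infty$.
   Context: A functional $F:\mathbb R^n\to\mathbb R$ is absolutely one-homogeneous if $F(\alpha u)=|\alpha|F(u)$ for all $\alpha\in\mathbb R$, $u\in\mathbb R^n$. $R(u):=J(u)/H(u)$, and the flow is considered where $H(u(t))\ne 0$. $\partial$ denotes the convex subdifferential: $\partial F(u)=\{p: F(v)\ge F(u)+\langle p,v-u\rangle\ \forall v\in\mathbb R^n\}$. $u_t$ is the time derivative of $u$. *)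

(* Defs.v *)
(* The real numbers are an abstract [R : realType] and R^n is the type
   ['cV[R]_n] of column vectors. *)
From HB Require Import structures.
From mathcomp Require Import all_boot all_order all_algebra.
From mathcomp Require Import all_classical all_reals all_analysis.

Set Implicit Arguments.
Unset Strict Implicit.
Unset Printing Implicit Defensive.

Import Order.TTheory GRing.Theory Num.Theory.
Import numFieldNormedType.Exports.

Local Open Scope classical_set_scope.
Local Open Scope ring_scope.

(* The norm carried by ['cV[R]_n] in the library is the sup norm, hence the
   explicit Euclidean inner product and norm. *)
Definition dotv (R : realType) (n : nat) (u v : 'cV[R]_n) : R :=
  \sum_(i < n) u i 0 * v i 0.

Definition norm2 (R : realType) (n : nat) (u : 'cV[R]_n) : R :=
  Num.sqrt (dotv u u).

(* The domain is nonempty and -oo is not attained. *)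
Definition proper_functional (R : realType) (n : nat) (F : 'cV[R]_n -> \bar R) : Prop :=
  (exists u, (F u < +oo)%E) /\ (forall u, (-oo < F u)%E).

Definition abs_one_homogeneous (R : realType) (n : nat)
    (F : 'cV[R]_n -> R) : Prop :=
  forall (a : R) (u : 'cV[R]_n), F (a *: u) = `|a| * F u.

(* Properness and lower semicontinuity are notions on extended-real functions;
   a real-valued functional is embedded with [%:E]. *)
Definition proper_convex_lsc_hom (R : realType) (n : nat)
    (F : 'cV[R]_n -> R) : Prop :=
  [/\ proper_functional (fun u => (F u)%:E),
      convex_function [set: convex_lmodType 'cV[R]_n] F,
      lower_semicontinuous (fun u => (F u)%:E)
    & abs_one_homogeneous F].

Definition subdifferential (R : realType) (n : nat)
    (F : 'cV[R]_n -> R) (u : 'cV[R]_n) : set 'cV[R]_n :=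
  [set p | forall v : 'cV[R]_n, F u + dotv p (v - u) <= F v].

Definition rayleigh_quotient (R : realType) (n : nat)
    (J H : 'cV[R]_n -> R) (u : 'cV[R]_n) : R := J u / H u.

Definition coercive (R : realType) (m n : nat) (A : 'M[R]_(m, n)) : Prop :=
  exists2 c : R, 0 < c & forall u : 'cV[R]_n, c * norm2 u <= norm2 (A *m u).

(* [v] is the derivative at [t] of the restriction of [u] to [D]: difference
   quotients are only taken at points of [D], so this is the one-sided
   derivative when [t] is an endpoint of an interval [D]. *)
Definition has_derivative_within (R : realType) (n : nat) (D : set R)
    (u : R -> 'cV[R]_n) (t : R) (v : 'cV[R]_n) : Prop :=
  (s - t)^-1 *: (u s - u t) @[s --> within D t^'] --> v.

(* [u] is only constrained on [0, +oo[; [du], [p] and [q] are the derivative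
   and the subgradient selections along the trajectory. *)
Definition is_flow (R : realType) (m n : nat) (J H : 'cV[R]_n -> R)
    (lambda : R) (A : 'M[R]_(m, n)) (f : 'cV[R]_m)
    (u du p q : R -> 'cV[R]_n) : Prop :=
  forall t : R, 0 <= t ->
    [/\ has_derivative_within `[0, +oo[ u t (du t),
        H (u t) != 0,
        p t \in subdifferential J (u t),
        q t \in subdifferential H (u t)
      & du t = - (lambda *: (A^T *m (A *m u t - f)))
               - (H (u t))^-1 *: (p t - rayleigh_quotient J H (u t) *: q t)].

(* Main.v *)
Require Import Defs.
From HB Require Import structures.
From mathcomp Require Import all_boot all_order all_algebra.
From mathcomp Require Import ring lra.
From mathcomp Require Import all_classical all_reals all_analysis.

Set Implicit Arguments.
Unset Strict Implicit.
Unset Printing Implicit Defensive.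

Import Order.TTheory GRing.Theory Num.Theory.
Import numFieldNormedType.Exports.

Local Open Scope classical_set_scope.
Local Open Scope ring_scope.

(** Along the flow the nonsmooth term is orthogonal to [u].  By Euler's identity
    ([subdifferential_euler]) a subgradient of an absolutely one-homogeneous
    functional satisfies [dotv p u = F u], and the Rayleigh quotient is exactly
    the coefficient for which [J u - (J u / H u) * H u = 0].  Hence only the
    data term contributes to the evolution of the energy [g = |u|^2]:
    [g' = - 2 lambda (|A u|^2 - <A u, f>)] ([dotv_flow]).

    Young's inequality and coercivity then give
    [g' <= lambda (|f|^2 - |A u|^2) <= lambda |f|^2 - lambda c^2 g], a linear
    differential inequality whose damping pulls [g] back below
    [|f|^2 / c^2]; by [gronwall_affine], [g] never exceeds the larger of [g 0]
    and [|f|^2 / c^2].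

    The derivative of [u] is vector-valued and relative to [0, +oo[, so the
    comparison argument receives what it needs coordinate by coordinate: an
    ordinary derivative at each [t > 0] and right-continuity at [0]. *)

Section InnerProduct.
Context {R : realType}.

Lemma dotv_mulmx n (u v : 'cV[R]_n) : dotv u v = (u^T *m v) 0 0.
Proof. by rewrite mxE; apply: eq_bigr => i _; rewrite mxE. Qed.

Lemma dotvC n (u v : 'cV[R]_n) : dotv u v = dotv v u.
Proof. by apply: eq_bigr => i _; rewrite mulrC. Qed.

Lemma dotvBl n (u v w : 'cV[R]_n) : dotv (u - v) w = dotv u w - dotv v w.
Proof. by rewrite !dotv_mulmx linearB mulmxBl !mxE. Qed.

Lemma dotvZl n a (u w : 'cV[R]_n) : dotv (a *: u) w = a * dotv u w.
Proof. by rewrite !dotv_mulmx linearZ -scalemxAl mxE. Qed.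

Lemma dotvNl n (u w : 'cV[R]_n) : dotv (- u) w = - dotv u w.
Proof. by rewrite -scaleN1r dotvZl mulN1r. Qed.

Lemma dotvBr n (u v w : 'cV[R]_n) : dotv w (u - v) = dotv w u - dotv w v.
Proof. by rewrite dotvC dotvBl !(dotvC w). Qed.

Lemma dotvZr n a (u w : 'cV[R]_n) : dotv w (a *: u) = a * dotv w u.
Proof. by rewrite dotvC dotvZl dotvC. Qed.

Lemma dotvv_ge0 n (u : 'cV[R]_n) : 0 <= dotv u u.
Proof. by apply: sumr_ge0 => i _; rewrite -expr2 sqr_ge0. Qed.

Lemma dotv_trmx m n (A : 'M[R]_(m, n)) u v :
  dotv (A^T *m v) u = dotv v (A *m u).
Proof. by rewrite !dotv_mulmx trmx_mul trmxK mulmxA. Qed.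

Lemma sqr_norm2 n (u : 'cV[R]_n) : norm2 u ^+ 2 = dotv u u.
Proof. by rewrite sqr_sqrtr ?dotvv_ge0. Qed.

(** The case [|u - v|^2 >= 0] of Young's inequality. *)
Lemma dotv_young n (u v : 'cV[R]_n) : 2 * dotv u v <= dotv u u + dotv v v.
Proof.
by have := dotvv_ge0 (u - v); rewrite dotvBl !dotvBr (dotvC v u); lra.
Qed.

Lemma coercive_sqr m n (A : 'M[R]_(m, n)) (c : R) (u : 'cV[R]_n) : 0 < c ->
  c * norm2 u <= norm2 (A *m u) ->
  c ^+ 2 * dotv u u <= dotv (A *m u) (A *m u).
Proof.
move=> c0 cA; rewrite -!sqr_norm2 -exprMn ler_sqr// nnegrE.
- by rewrite mulr_ge0 ?(ltW c0)// sqrtr_ge0.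
- exact: sqrtr_ge0.
Qed.

End InnerProduct.

Section Subgradients.
Context {R : realType}.

(** Euler's identity: along the ray through [u] the functional is linear, so the
    subgradient inequality tested at [2 u] and at [0] gives both bounds. *)
Lemma subdifferential_euler n (F : 'cV[R]_n -> R) (u p : 'cV[R]_n) :
  abs_one_homogeneous F -> p \in subdifferential F u -> dotv p u = F u.
Proof.
rewrite inE => Fhom pF; apply/eqP; rewrite eq_le; apply/andP; split.
- by have := pF (2 *: u); rewrite Fhom dotvBr dotvZr normr_nat; lra.
- by have := pF (0 *: u); rewrite Fhom dotvBr dotvZr normr0; lra.
Qed.

(** The radial component of the flow's right-hand side: both subgradient terms
    pair with [u] to [J u], so they cancel and only the data term is left. *)
Lemma dotv_flow m n (J H : 'cV[R]_n -> R) lambda (A : 'M[R]_(m, n)) f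
    (u p q : 'cV[R]_n) :
  abs_one_homogeneous J -> abs_one_homogeneous H -> H u != 0 ->
  p \in subdifferential J u -> q \in subdifferential H u ->
  dotv (- (lambda *: (A^T *m (A *m u - f)))
        - (H u)^-1 *: (p - rayleigh_quotient J H u *: q)) u
  = - lambda * (dotv (A *m u) (A *m u) - dotv (A *m u) f).
Proof.
move=> Jhom Hhom Hu0 pJ qH.
rewrite dotvBl dotvNl !dotvZl dotvBl dotvZl.
rewrite (subdifferential_euler Jhom pJ) (subdifferential_euler Hhom qH).
rewrite /rayleigh_quotient divfK// subrr mulr0 subr0.
by rewrite dotv_trmx dotvBl (dotvC f) mulNr.
Qed.

End Subgradients.

Section Derivatives.
Context {R : realType}.

Lemma has_derivative_within_coord n D (u : R -> 'cV[R]_n) t v i :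
  has_derivative_within D u t v ->
  (s - t)^-1 * (u s i 0 - u t i 0) @[s --> within D t^'] --> v i 0.
Proof.
move=> h.
have := cvg_comp _ _ h (@coord_continuous R n 1 i 0 v).
apply: cvg_trans; apply: near_eq_cvg.
by apply: nearW => s /=; rewrite !mxE.
Qed.

(** At an interior point the restriction to [D] is invisible to the punctured
    neighbourhood filter, so the relative derivative is the ordinary one. *)
Lemma has_derivative_within_derive n (D : set R) (u : R -> 'cV[R]_n) t v i :
  D° t -> has_derivative_within D u t v ->
  is_derive t 1 (fun s => u s i 0) (v i 0).
Proof.
move=> Dt /has_derivative_within_coord - /(_ i) h.
have {}h : (s - t)^-1 * (u s i 0 - u t i 0) @[s --> t^'] --> v i 0.
  apply: cvg_trans h; apply: cvg_app => A hA.
  suff : nbhs t (fun x => x != t -> A x) by [].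
  (* Filters [within] and [dnbhs] unfold to implications under [nbhs]. *)
  have {}hA : nbhs t (fun x => x != t -> D x -> A x) by exact: hA.
  by apply: filterS2 hA Dt => x hx Dx xt; exact: hx.
suff dq : s^-1 *: (((fun s => u s i 0) \o shift t) (s *: 1) - u t i 0)
    @[s --> 0^'] --> v i 0.
  apply: DeriveDef; first by apply/cvg_ex; exists (v i 0).
  exact/cvg_lim.
(* Change of variable from the endpoint [s] to the increment [s - t]. *)
have sh : (s + t) @[s --> (0 : R)^'] --> t^'.
  have st : (s + t) @[s --> (0 : R)] --> t.
    rewrite -[X in _ --> X]add0r.
    by apply: cvgD; [exact: cvg_id|exact: cvg_cst].
  move=> A At; have {}At : nbhs t (fun x => x != t -> A x) by exact: At.
  suff : nbhs 0 (fun s : R => s != 0 -> A (s + t)) by [].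
  have {st} : nbhs 0 (fun s : R => s + t != t -> A (s + t)).
    exact: (st _ At).
  apply: filterS => s hs s0; apply: hs.
  by rewrite -subr_eq0 addrK.
have := cvg_comp _ _ sh h; apply: cvg_trans; apply: near_eq_cvg.
by apply: nearW => s /=; rewrite addrK /GRing.scale/= mulr1.
Qed.

(** Continuity relative to [D], which is all that the one-sided derivative at an
    endpoint provides: the increment is [(s - t)] times a convergent
    quotient. *)
Lemma has_derivative_within_cvg n (D : set R) (u : R -> 'cV[R]_n) t v i :
  has_derivative_within D u t v -> u s i 0 @[s --> within D t^'] --> u t i 0.
Proof.
move=> /has_derivative_within_coord - /(_ i) h.
have FF : Filter (within D t^') by exact: within_filter.
have st : (s - t) @[s --> within D t^'] --> 0.
  rewrite -[X in _ --> X](subrr t); apply: cvgB; last exact: cvg_cst.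
  move=> A At; suff : nbhs t (fun s => s != t -> D s -> A s) by [].
  by apply: filterS At => s As _ _.
have ut : (s - t) * ((s - t)^-1 * (u s i 0 - u t i 0)) + u t i 0
    @[s --> within D t^'] --> u t i 0.
  rewrite -[X in _ --> X]add0r -[X in X + _](mul0r (v i 0)).
  by apply: cvgD; [exact: cvgM|exact: cvg_cst].
apply: cvg_trans ut; apply: near_eq_cvg.
suff : \forall s \near t, s != t -> D s ->
    (s - t) * ((s - t)^-1 * (u s i 0 - u t i 0)) + u t i 0 = u s i 0 by [].
apply: (@nearW _ (nbhs t)) => s st0 _.
by rewrite mulrA mulfV ?subr_eq0// mul1r subrK.
Qed.

(** With the integrating factor [expR (a * t)], the excess of [g] over the
    equilibrium [b / a] is nonincreasing; a positive excess therefore decays,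
    and stays below the initial one. *)
Lemma gronwall_affine (g dg : R -> R) (a b : R) : 0 < a ->
  {within `[0, +oo[, continuous g} ->
  (forall t : R, 0 < t -> is_derive t 1 g (dg t)) ->
  (forall t : R, 0 < t -> dg t <= b - a * g t) ->
  forall t : R, 0 <= t -> g t <= Num.max (g 0) (b / a).
Proof.
move=> a0 gc gd dgle t t0.
pose h s := expR (a * s) * (g s - b / a).
have hd (s : R) : 0 < s -> is_derive s 1 h
    (expR (a * s) * dg s + (g s - b / a) * (a * expR (a * s))).
  move=> s0; have ? := gd s s0.
  have ? : is_derive s 1 (fun x => expR (a * x)) (a * expR (a * s)).
    have ? : is_derive s 1 (fun x : R => a * x) a.
      rewrite (_ : (fun x => a * x) = a \*: id)//.
      by apply: is_derive_eq; rewrite /GRing.scale/= mulr1.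
    by apply: is_derive_eq; rewrite mulrC.
  have ? : is_derive s 1 (fun x => g x - b / a) (dg s).
    by apply: is_derive_eq; rewrite subr0.
  exact: is_deriveM.
have : h t <= h 0.
  apply: (@ler0_derive1_nincry R h 0) => //.
  - by move=> s; rewrite in_itv/= andbT => /hd [].
  - move=> s; rewrite in_itv/= andbT => s0; have [_] := hd s s0.
    rewrite derive1E => ->.
    have -> : expR (a * s) * dg s + (g s - b / a) * (a * expR (a * s))
      = expR (a * s) * (dg s - (b - a * g s)) by field; lra.
    by rewrite mulr_ge0_le0 ?expR_ge0// subr_le0 dgle.
  - have ec : {within `[0, +oo[, continuous (fun s => expR (a * s))}.
      apply: continuous_subspaceT => s; apply: continuous_comp.
        exact: mulrl_continuous.
      exact: continuous_expR.
    move=> s; apply: cvgM; first exact: ec.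
    by apply: cvgB; [exact: gc|exact: cvg_cst].
rewrite /h mulr0 expR0 mul1r => hle.
rewrite le_max; have [gb|gb] := leP (g t) (b / a); first by rewrite orbT.
rewrite orbF -(lerD2r (- (b / a))); apply: le_trans hle.
rewrite ler_peMl//; first by rewrite subr_ge0 ltW.
by rewrite -expR0 ler_expR mulr_ge0// ltW.
Qed.

End Derivatives.

Theorem corollary1 (R : realType) (m n : nat) (J H : 'cV[R]_n -> R)
    (lambda : R) (A : 'M[R]_(m, n)) (f : 'cV[R]_m) :
  proper_convex_lsc_hom J ->
  proper_convex_lsc_hom H ->
  0 < lambda ->
  coercive A ->
  forall u du p q : R -> 'cV[R]_n,
    is_flow J H lambda A f u du p q ->
    (ereal_sup [set (norm2 (u t))%:E | t in [set t : R | (0 <= t)%R]] < +oo)%E.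
Proof.
move=> [_ _ _ Jhom] [_ _ _ Hhom] l0 [c c0 cA] u du p q flow.
pose g t := dotv (u t) (u t).
have gE : g = \sum_(i < n) ((fun t => u t i 0) * (fun t => u t i 0)).
  by apply/funext => t; rewrite fct_sumE.
have gd (t : R) : 0 < t -> is_derive t 1 g (2 * dotv (du t) (u t)).
  move=> t0; have [ud _ _ _ _] := flow t (ltW t0).
  have Dt : (`[0, +oo[%classic : set R)° t.
    by rewrite interior_itv_bndy/= in_itv/= t0.
  have ? i := has_derivative_within_derive i Dt ud.
  rewrite gE; apply: is_derive_eq.
  rewrite mulr_sumr; apply: eq_bigr => i _.
  by rewrite /GRing.scale/=; ring.
have gc : {within `[0, +oo[, continuous g}.
  apply/continuous_within_itvcyP; split.
    move=> t; rewrite in_itv/= andbT => /gd [+ _].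
    by move=> /derivable1_diffP/differentiable_continuous.
  have [ud _ _ _ _] := flow 0 (lexx 0).
  apply: cvg_big => [|i _]; first exact: add_continuous.
  have h := has_derivative_within_cvg (i := i) ud.
  suff u0 : u t i 0 @[t --> 0^'+] --> u 0 i 0 by exact: (cvgM u0 u0).
  apply: cvg_trans h; apply: cvg_app => B hB.
  suff : nbhs (0 : R) (fun x => 0 < x -> B x) by [].
  have {}hB : nbhs (0 : R) (fun x => x != 0 -> `[0, +oo[%classic x -> B x).
    exact: hB.
  apply: filterS hB => x hx x0; apply: hx; first by rewrite gt_eqF.
  by rewrite /= in_itv/= andbT ltW.
have gle (t : R) : 0 <= t ->
    g t <= Num.max (g 0) (lambda * dotv f f / (lambda * c ^+ 2)).
  apply: (gronwall_affine _ gc gd); first by rewrite mulr_gt0// exprn_gt0.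
  move=> s s0; have [_ Hu0 pJ qH ->] := flow s (ltW s0).
  rewrite (dotv_flow _ _ _ Jhom Hhom Hu0 pJ qH).
  have := coercive_sqr c0 (cA (u s)); have := dotv_young (A *m u s) f.
  rewrite -/(g s); nra.
apply: (@le_lt_trans _ _ (Num.sqrt (Num.max (g 0)
  (lambda * dotv f f / (lambda * c ^+ 2))))%:E); last exact: ltry.
apply: ge_ereal_sup => _ [t t0 <-].
by rewrite lee_fin ler_wsqrtr// gle.
Qed.
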